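(* Let $\mu_1,\mu_2$ be positive measures on the real line, all of whose moments exist, such that all indices $(n,m)\in\mathbb{N}^2$ are normal. Let $P_{n,m}$ be the type II multiple orthogonal polynomials for $(\mu_1,\mu_2)$ and let $a_{n,m},b_{n,m},c_{n,m},d_{n,m}$ be the recurrence coefficients in $$P_{n+1,m}(x)=(x-c_{n,m})P_{n,m}(x)-a_{n,m}P_{n-1,m}(x)-b_{n,m}P_{n,m-1}(x),$$ $$P_{n,m+1}(x)=(x-d_{n,m})P_{n,m}(x)-a_{n,m}P_{n-1,m}(x)-b_{n,m}P_{n,m-1}(x).$$ Then for all $n,m\ge 0$ $$d_{n+1,m}-d_{n,m}=c_{n,m+1}-c_{n,m},$$ $$b_{n+1,m}-b_{n,m+1}+a_{n+1,m}-a_{n,m+1}=\det\begin{pmatrix} d_{n+1,m}&d_{n,m}\\ c_{n,m+1}&c_{n,m}\end{pmatrix},$$ for all $n\ge1$, $m\ge 0$ $$\frac{a_{n,m+1}}{a_{n,m}}=\frac{c_{n,m}-d_{n,m}}{c_{n-1,m}-d_{n-1,m}},$$ and for all $n\ge0$, $m\ge1$ $$\frac{b_{n+1,m}}{b_{n,m}}=\frac{c_{n,m}-d_{n,m}}{c_{n,m-1}-d_{n,m-1}}.$$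
   Context: $\mathbb{N}=\{0,1,2,\dots\}$. The type II multiple orthogonal polynomial $P_{n,m}$ is the monic polynomial of degree $n+m$ with $\int P_{n,m}(x)x^k\,d\mu_1(x)=0$ for $0\le k\le n-1$ and $\int P_{n,m}(x)x^k\,d\mu_2(x)=0$ for $0\le k\le m-1$. The index $(n,m)$ is called normal if the $(n+m)\times(n+m)$ matrix $M_{n,m}$ is nonsingular, where $M_{n,m}$ consists of two blocks side by side: the $(n+m)\times n$ matrix $(\nu^{(1)}_{s+t})$, $0\le s\le n+m-1$, $0\le t\le n-1$, and the $(n+m)\times m$ matrix $(\nu^{(2)}_{s+t})$, $0\le s\le n+m-1$, $0\le t\le m-1$, with $\nu^{(j)}_k=\int x^k\,d\mu_j(x)$ (for $(n,m)=(0,0)$ the empty matrix, considered nonsingular). Normality of $(n,m)$ is equivalent to existence and uniqueness of $P_{n,m}$. When all indices are normal, the stated recurrence relations hold for all $n,m\ge0$ with $a_{0,m}=0$ and $b_{n,0}=0$ (the terms with a negative index being absent), $a_{n,m}=\int x^nP_{n,m}\,d\mu_1\big/\int x^{n-1}P_{n-1,m}\,d\mu_1$ for $n\ge1$ and $b_{n,m}=\int x^mP_{n,m}\,d\mu_2\big/\int x^{m-1}P_{n,m-1}\,d\mu_2$ for $m\ge1$. *)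

(* Defs.v *)
From HB Require Import structures.
From mathcomp Require Import all_boot all_order all_algebra.
From mathcomp Require Import all_classical all_reals all_analysis.

Set Implicit Arguments.
Unset Strict Implicit.
Unset Printing Implicit Defensive.

Import Order.TTheory GRing.Theory Num.Theory.

Local Open Scope classical_set_scope.
Local Open Scope ring_scope.

Definition has_all_moments (R : realType)
    (mu : {measure set (measurableTypeR R) -> \bar R}) : Prop :=
  forall k : nat, mu.-integrable setT (fun x : R => (x ^+ k)%:E).

Definition moment (R : realType)
    (mu : {measure set (measurableTypeR R) -> \bar R}) (k : nat) : R :=
  \int[mu]_(x in setT) (x ^+ k).

Definition moment_mx (R : realType)
    (mu1 mu2 : {measure set (measurableTypeR R) -> \bar R}) (n m : nat) :
    'M[R]_(n + m) :=
  row_mx (\matrix_(s < n + m, t < n) moment mu1 (s + t))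
         (\matrix_(s < n + m, t < m) moment mu2 (s + t)).

Definition normal_index (R : realType)
    (mu1 mu2 : {measure set (measurableTypeR R) -> \bar R}) (n m : nat) : Prop :=
  moment_mx mu1 mu2 n m \in unitmx.

Definition typeII_MOP (R : realType)
    (mu1 mu2 : {measure set (measurableTypeR R) -> \bar R}) (n m : nat)
    (p : {poly R}) : Prop :=
  [/\ p \is monic,
      size p = (n + m).+1,
      forall k : nat, (k < n)%N -> \int[mu1]_(x in setT) (p.[x] * x ^+ k) = 0 &
      forall k : nat, (k < m)%N -> \int[mu2]_(x in setT) (p.[x] * x ^+ k) = 0].

(* The terms carrying a negative index are absent: at n = 0 (resp. m = 0) the
   truncated predecessor makes P n.-1 m (resp. P n m.-1) a junk value, which
   the first (resp. second) clause multiplies by 0.  For n, m >= 1 the values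
   of a and b are not prescribed separately: integrating the first recurrence
   against x^(n-1) d mu1 and x^(m-1) d mu2 gives their usual expressions as
   quotients of integrals. *)
Definition recurrence_coefs (R : realType) (P : nat -> nat -> {poly R})
    (a b c d : nat -> nat -> R) : Prop :=
  [/\ forall m : nat, a 0%N m = 0,
      forall n : nat, b n 0%N = 0,
      forall n m : nat,
        P n.+1 m = ('X - (c n m)%:P) * P n m
                   - a n m *: P n.-1 m - b n m *: P n m.-1 &
      forall n m : nat,
        P n m.+1 = ('X - (d n m)%:P) * P n m
                   - a n m *: P n.-1 m - b n m *: P n m.-1].

Definition mx22 (R : realType) (p q r s : R) : 'M[R]_2 :=
  \matrix_(i < 2, j < 2)
    if i == 0 then (if j == 0 then p else q) else (if j == 0 then r else s).

(* Main.v *)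
(* Normality says that a polynomial of degree less than n + m satisfying the
   orthogonality conditions of index (n, m) vanishes.  Hence
   h_{n,m} = \int x^n P_{n,m} dmu_1 is nonzero, and so is c_{n,m} - d_{n,m},
   since P_{n+1,m} = P_{n,m+1} would meet the conditions of index (n+1, m+1).
   Integrating the recurrences gives a_{n,m} = h_{n,m} / h_{n-1,m} and
   h_{n,m+1} = (c_{n,m} - d_{n,m}) h_{n,m}, whence the ratio for a; the ratio
   for b follows by exchanging the two measures.  The two additive identities
   compare the coefficients of x^{n+m+1} and x^{n+m} in the two expressions of
   P_{n+1,m+1} obtained through P_{n+1,m} and through P_{n,m+1}. *)
Require Import Defs.
From HB Require Import structures.
From mathcomp Require Import all_boot all_order all_algebra.
From mathcomp Require Import all_classical all_reals all_analysis.
From mathcomp Require Import ring lra.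

Set Implicit Arguments.
Unset Strict Implicit.
Unset Printing Implicit Defensive.

Import Order.TTheory GRing.Theory Num.Theory.

Local Open Scope ring_scope.

(** Stands for integration against a measure with moments [s], so that everything after
    [Rintegral_horner] is linear algebra on coefficients. *)
Definition moment_functional (F : nzRingType) (s : nat -> F) (p : {poly F}) : F :=
  \sum_(i < size p) p`_i * s i.

Lemma moment_functionalE (F : nzRingType) (s : nat -> F) (p : {poly F}) (N : nat) :
  (size p <= N)%N -> moment_functional s p = \sum_(i < N) p`_i * s i.
Proof.
move=> pN; rewrite /moment_functional (big_ord_widen N (fun i => p`_i * s i)) //.
rewrite big_mkcond /=; apply: eq_bigr => i _; case: ltnP => // /(nth_default 0) ->.
by rewrite mul0r.
Qed.

Lemma moment_functional_is_linear (F : nzRingType) (s : nat -> F) :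
  linear_for *%R (moment_functional s).
Proof.
move=> u p q; set r := u *: p + q; pose N := maxn (size r) (maxn (size p) (size q)).
have [Nr Np Nq] : [/\ (size r <= N)%N, (size p <= N)%N & (size q <= N)%N].
  by rewrite /N !leq_max !leqnn !orbT.
rewrite !(@moment_functionalE _ _ _ N) // /r mulr_sumr -big_split /=.
by apply: eq_bigr => i _; rewrite coefD coefZ mulrDl mulrA.
Qed.

HB.instance Definition _ (F : nzRingType) (s : nat -> F) :=
  GRing.isLinear.Build F {poly F} F *%R (moment_functional s)
    (moment_functional_is_linear s).

Lemma moment_functionalMXn (F : nzRingType) (s : nat -> F) (p : {poly F}) (N k : nat) :
  (size p <= N)%N ->
  moment_functional s (p * 'X^k) = \sum_(i < N) p`_i * s (i + k)%N.
Proof.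
move=> pN; rewrite (@moment_functionalE _ _ _ (k + N)); last first.
  by rewrite (leq_trans (size_polyMleq _ _)) // size_polyXn addnS addnC leq_add2l.
rewrite big_split_ord /= big1 ?add0r => [|i _]; last first.
  by rewrite coefMXn ltn_ord mul0r.
by apply: eq_bigr => i _; rewrite coefMXn ltnNge leq_addr /= addKn addnC.
Qed.

Section Integral.
Variables (R : realType) (mu : {measure set (measurableTypeR R) -> \bar R}).
Hypothesis mom : has_all_moments mu.

(** Every monomial is integrable, so the integral splits over the finite sum and each term is
    finite, which makes [fine] additive and multiplicative here. *)
Lemma Rintegral_horner (p : {poly R}) :
  \int[mu]_(x in setT) p.[x] = moment_functional (moment mu) p.
Proof.
have int_term i : mu.-integrable setT (fun x : R => (p`_i)%:E * (x ^+ i)%:E)%E.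
  by apply: integrableZl => //; exact: mom.
rewrite [LHS](_ : _ = fine (\int[mu]_(x in setT)
    (\sum_(i < size p) (p`_i)%:E * (x ^+ i)%:E))%E); last first.
  by congr fine; apply: eq_integral => x _; rewrite horner_coef -sumEFin.
rewrite integral_sum // -sum_fine => [|i _]; last exact: integrable_fin_num.
apply: eq_bigr => i _; rewrite integralZl //.
by rewrite fineM // integrable_fin_num //; exact: mom.
Qed.

End Integral.

Definition biorthogonal (F : nzRingType) (s1 s2 : nat -> F) (n m : nat) (p : {poly F}) : Prop :=
  (forall k, (k < n)%N -> moment_functional s1 (p * 'X^k) = 0) /\
  (forall k, (k < m)%N -> moment_functional s2 (p * 'X^k) = 0).

Definition normal_moments (F : nzRingType) (s1 s2 : nat -> F) : Prop :=
  forall n m (p : {poly F}), (size p <= n + m)%N -> biorthogonal s1 s2 n m p -> p = 0.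

Lemma biorthogonalC (F : nzRingType) (s1 s2 : nat -> F) n m p :
  biorthogonal s1 s2 n m p -> biorthogonal s2 s1 m n p.
Proof. by case. Qed.

Lemma normal_momentsC (F : nzRingType) (s1 s2 : nat -> F) :
  normal_moments s1 s2 -> normal_moments s2 s1.
Proof. by move=> N n m p; rewrite addnC => sp /biorthogonalC; exact: N. Qed.

(** The orthogonality conditions say that the coefficient row of [p] lies in the left kernel of the
    moment matrix, which is invertible. *)
Lemma normal_index_moments (R : realType)
    (mu1 mu2 : {measure set (measurableTypeR R) -> \bar R}) :
  (forall n m, normal_index mu1 mu2 n m) ->
  normal_moments (moment mu1) (moment mu2).
Proof.
move=> N n m p sp [h1 h2].
pose u := \row_(i < n + m) p`_i.
have u0 : u *m moment_mx mu1 mu2 n m = 0.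
  rewrite /moment_mx mul_mx_row -[RHS](@row_mx0 _ 1 n m); congr row_mx.
  - apply/rowP => k; rewrite !mxE -[RHS](h1 k) // (moment_functionalMXn _ _ sp).
    by apply: eq_bigr => i _; rewrite !mxE.
  - apply/rowP => k; rewrite !mxE -[RHS](h2 k) // (moment_functionalMXn _ _ sp).
    by apply: eq_bigr => i _; rewrite !mxE.
have {}u0 : u = 0 by rewrite -[u](mulmxK (N n m)) u0 mul0mx.
apply/polyP => i; rewrite coef0; have [ilt|ige] := ltnP i (n + m).
  by have /rowP /(_ (Ordinal ilt)) := u0; rewrite !mxE.
by rewrite nth_default // (leq_trans sp).
Qed.

(** Exchanging the measures transposes the indices and swaps [a] with [b] and [c] with [d]; the
    ratio for [b] is obtained this way. *)
Lemma recurrence_coefsC (R : realType) (P : nat -> nat -> {poly R})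
    (a b c d : nat -> nat -> R) :
  recurrence_coefs P a b c d ->
  recurrence_coefs (fun n m => P m n) (fun n m => b m n) (fun n m => a m n)
    (fun n m => d m n) (fun n m => c m n).
Proof. by case=> a0 b0 r1 r2; split=> // n m; rewrite (r1, r2) addrAC. Qed.

Lemma recurrence_sub (R : realType) (P : nat -> nat -> {poly R})
    (a b c d : nat -> nat -> R) n m :
  recurrence_coefs P a b c d ->
  P n.+1 m = P n m.+1 - (c n m - d n m) *: P n m.
Proof. by case=> _ _ r1 r2; rewrite r1 r2 -!mul_polyC rmorphB /=; ring. Qed.

Section Compatibility.
Variables (R : realType) (P : nat -> nat -> {poly R}) (a b c d : nat -> nat -> R).
Hypothesis monP : forall n m, P n m \is monic.
Hypothesis sizeP : forall n m, size (P n m) = (n + m).+1.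
Hypothesis recP : recurrence_coefs P a b c d.

Let coefP_top n m k : k = (n + m)%N -> (P n m)`_k = 1.
Proof. by move=> ->; have /monicP := monP n m; rewrite /lead_coef sizeP. Qed.

Let coefP_gt n m k : (n + m < k)%N -> (P n m)`_k = 0.
Proof. by move=> lk; rewrite nth_default // sizeP. Qed.

(** For [n >= 1] the degree [n - 1 + m] is below [k]; at [n = 0] the junk value [P 0 m] may have a
    nonzero coefficient, and [a 0 m = 0] kills it. *)
Let a_coef n m k : (n + m <= k)%N -> a n m * (P n.-1 m)`_k = 0.
Proof.
have [a0 _ _ _] := recP; case: n => [|n] nk; first by rewrite a0 mul0r.
by rewrite coefP_gt ?mulr0.
Qed.

Let b_coef n m k : (n + m <= k)%N -> b n m * (P n m.-1)`_k = 0.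
Proof.
have [_ b0 _ _] := recP; case: m => [|m] mk; first by rewrite b0 mul0r.
by rewrite coefP_gt ?mulr0 // -addnS.
Qed.

Let a_coef_top n m : a n m.+1 * (P n.-1 m.+1)`_(n + m) = a n m.+1.
Proof.
have [a0 _ _ _] := recP; case: n => [|n]; first by rewrite a0 mul0r.
by rewrite coefP_top ?mulr1 // addnS.
Qed.

Let b_coef_top n m : b n.+1 m * (P n.+1 m.-1)`_(n + m) = b n.+1 m.
Proof.
have [_ b0 _ _] := recP; case: m => [|m]; first by rewrite b0 mul0r.
by rewrite coefP_top ?mulr1 // addnS.
Qed.

(* Both sides are [P n.+1 m.+1], reached from [P n m] through [(n+1, m)] and
   through [(n, m+1)]; [P n.+1 m] is rewritten by [recurrence_sub]. *)
Let two_paths n m :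
  ('X - (d n.+1 m)%:P) * (P n m.+1 - (c n m - d n m) *: P n m)
    - a n.+1 m *: P n m - b n.+1 m *: P n.+1 m.-1
  = ('X - (c n m.+1)%:P) * P n m.+1
    - a n m.+1 *: P n.-1 m.+1 - b n m.+1 *: P n m.
Proof.
have [_ _ r1 r2] := recP.
by rewrite -(recurrence_sub n m recP) -[LHS](r2 n.+1 m) (r1 n m.+1).
Qed.

(** The products ['X * P n m.+1] on the two sides of [two_paths] cancel; the remaining terms are
    sorted by polynomial. *)
Let coef_two_paths n m k :
  (d n.+1 m - c n m.+1) * (P n m.+1)`_k + (c n m - d n m) * ('X * P n m)`_k
  = ((c n m - d n m) * d n.+1 m - a n.+1 m + b n m.+1) * (P n m)`_k
    + a n m.+1 * (P n.-1 m.+1)`_k - b n.+1 m * (P n.+1 m.-1)`_k.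
Proof.
have /(congr1 (fun p : {poly R} => p`_k)) := two_paths n m.
rewrite mulrBr -scalerAr !mulrBl !(coefB, coefZ, coefCM) => e.
by apply/subr0_eq; move/esym/eqP: e; rewrite -subr_eq0 => /eqP e; rewrite -[RHS]e; ring.
Qed.

Lemma coef_diff n m : d n.+1 m - d n m = c n m.+1 - c n m.
Proof.
have := coef_two_paths n m (n + m).+1.
rewrite a_coef ?addnS // b_coef ?addSn // coefXM /=.
rewrite (@coefP_gt n m _ (ltnSn _)) (coefP_top (esym (addnS n m))) (@coefP_top n m _ erefl); lra.
Qed.

Lemma coef_det n m :
  b n.+1 m - b n m.+1 + a n.+1 m - a n m.+1
  = \det (mx22 (d n.+1 m) (d n m) (c n m.+1) (c n m)).
Proof.
have [_ _ _ r2] := recP.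
(* The coefficient of ['X * P n m] is the subleading one of [P n m], in a form that is also correct
   (namely 0) at [n = m = 0]. *)
have Q : (P n m.+1)`_(n + m) = ('X * P n m)`_(n + m) - d n m.
  rewrite r2 mulrBl !(coefB, coefZ, coefCM) a_coef // b_coef // coefP_top //.
  by rewrite mulr1 !subr0.
have := coef_two_paths n m (n + m).
(* With this substitution the unknown subleading coefficient of [P n m] gets the factor [(d n.+1 m -
   c n m.+1) + (c n m - d n m) = 0]. *)
have -> : c n m.+1 = d n.+1 m - d n m + c n m by have := coef_diff n m; lra.
rewrite Q a_coef_top b_coef_top coefP_top // => e.
rewrite (expand_det_row _ ord0) !big_ord_recl big_ord0 /cofactor !det_mx11 !mxE /=.
rewrite expr0 expr1; nra.
Qed.

End Compatibility.

Section Ratio.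
Variables (R : realType) (s1 s2 : nat -> R).
Hypothesis normal : normal_moments s1 s2.
Variables (P : nat -> nat -> {poly R}) (a b c d : nat -> nat -> R).
Hypothesis monP : forall n m, P n m \is monic.
Hypothesis sizeP : forall n m, size (P n m) = (n + m).+1.
Hypothesis orthP : forall n m, biorthogonal s1 s2 n m (P n m).
Hypothesis recP : recurrence_coefs P a b c d.

Lemma coef_sub_neq0 n m : c n m - d n m != 0.
Proof.
apply/eqP => cd; have := recurrence_sub n m recP.
rewrite cd scale0r subr0 => e.
have /eqP : P n.+1 m = 0.
  apply: (@normal n.+1 m.+1); first by rewrite sizeP addSnnS.
  by split; [case: (orthP n.+1 m) | rewrite e; case: (orthP n m.+1)].
by apply/negP; exact: monic_neq0.
Qed.

Let h n m := moment_functional s1 (P n m * 'X^n).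

(** Were it zero, [P n m] would satisfy one more condition, those of index [(n+1, m)], with degree
    only [n + m]. *)
Let h_neq0 n m : h n m != 0.
Proof.
apply/eqP => h0; have /eqP : P n m = 0.
  apply: (@normal n.+1 m); first by rewrite sizeP addSn.
  have [h1 h2] := orthP n m; split=> // k.
  by rewrite ltnS leq_eqVlt => /predU1P[->|/h1].
by apply/negP; exact: monic_neq0.
Qed.

(** [P n.+1 m] is orthogonal to [x^n] for the first functional; [recurrence_sub] expands it. *)
Let h_upper n m : h n m.+1 = (c n m - d n m) * h n m.
Proof.
have := orthP n.+1 m => -[/(_ n (ltnSn n)) + _].
rewrite (recurrence_sub n m recP) mulrBl -scalerAl linearB linearZ /=.
by move/eqP; rewrite subr_eq0 => /eqP.
Qed.

Let h_left n m : a n.+1 m * h n m = h n.+1 m.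
Proof.
have [_ b0 r1 _] := recP.
(* Test the recurrence for [P n.+2 m] against [x^n]: the [c] and [b] terms vanish, leaving
   [h n.+1 m] from the factor ['X] and the [a] term. *)
have := orthP n.+2 m => -[/(_ n (leqnSn _)) + _].
rewrite r1 /= !mulrBl !linearB /= mul_polyC -!scalerAl !scalarZ /=.
have [/(_ n (ltnSn n)) -> _] := orthP n.+1 m.
rewrite mulr0 subr0 mulrAC -exprS mulrC -/(h n.+1 m).
have -> : b n.+1 m * moment_functional s1 (P n.+1 m.-1 * 'X^n) = 0.
  case: m => [|m]; first by rewrite b0 mul0r.
  by have [/(_ n (ltnSn n)) -> _] := orthP n.+1 m; rewrite mulr0.
by rewrite subr0 => /eqP; rewrite subr_eq0 => /eqP.
Qed.

(** Division by zero returns 0, so the nonvanishing of both denominators is stated along with the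
    ratio. *)
Lemma coef_ratio n m : (1 <= n)%N ->
  [/\ a n m != 0, c n.-1 m - d n.-1 m != 0 &
      a n m.+1 / a n m = (c n m - d n m) / (c n.-1 m - d n.-1 m)].
Proof.
case: n => // n _ /=.
have aE k : a n.+1 k = h n.+1 k / h n k by rewrite -h_left mulfK.
split; [by rewrite aE mulf_neq0 ?invr_eq0 | exact: coef_sub_neq0 |].
have [? ? ? ?] := And4 (h_neq0 n m) (h_neq0 n.+1 m) (coef_sub_neq0 n m) (coef_sub_neq0 n.+1 m).
by rewrite !aE !h_upper; field; do ?[apply/andP; split].
Qed.

End Ratio.

Theorem theorem3p1 (R : realType)
    (mu1 mu2 : {measure set (measurableTypeR R) -> \bar R})
    (mom1 : has_all_moments mu1) (mom2 : has_all_moments mu2)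
    (normal12 : forall n m : nat, normal_index mu1 mu2 n m)
    (P : nat -> nat -> {poly R})
    (typeII_P : forall n m : nat, typeII_MOP mu1 mu2 n m (P n m))
    (a b c d : nat -> nat -> R)
    (rec_P : recurrence_coefs P a b c d) :
  [/\ forall n m : nat, d n.+1 m - d n m = c n m.+1 - c n m,
      forall n m : nat,
        b n.+1 m - b n m.+1 + a n.+1 m - a n m.+1
        = \det (mx22 (d n.+1 m) (d n m)
                     (c n m.+1) (c n m)),
      forall n m : nat, (1 <= n)%N ->
        [/\ a n m != 0, c n.-1 m - d n.-1 m != 0 &
            a n m.+1 / a n m = (c n m - d n m) / (c n.-1 m - d n.-1 m)] &
      forall n m : nat, (1 <= m)%N ->
        [/\ b n m != 0, c n m.-1 - d n m.-1 != 0 &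
            b n.+1 m / b n m = (c n m - d n m) / (c n m.-1 - d n m.-1)]].
Proof.
have monP n m : P n m \is monic by case: (typeII_P n m).
have sizeP n m : size (P n m) = (n + m).+1 by case: (typeII_P n m).
have intE mu (mom : has_all_moments mu) (p : {poly R}) k :
    \int[mu]_(x in setT) (p.[x] * x ^+ k) = moment_functional (moment mu) (p * 'X^k).
  by rewrite -Rintegral_horner //; under [RHS]eq_Rintegral do rewrite hornerM hornerXn.
have orthP n m : biorthogonal (moment mu1) (moment mu2) n m (P n m).
  by have [_ _ h1 h2] := typeII_P n m; split=> k; rewrite -intE //; [exact: h1|exact: h2].
have N := normal_index_moments normal12.
split.
- exact: (coef_diff monP sizeP rec_P).
- exact: (coef_det monP sizeP rec_P).
- exact: (coef_ratio N monP sizeP orthP rec_P).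
- move=> n m m1.
  have sizeP' k l : size (P l k) = (k + l).+1 by rewrite addnC.
  have [b0 dc0 r] := coef_ratio (normal_momentsC N) (fun k l => monP l k) sizeP'
    (fun k l => biorthogonalC (orthP l k)) (recurrence_coefsC rec_P) n m1.
  split=> //; first by rewrite -opprB oppr_eq0.
  (* The exchange produced [d - c] in numerator and denominator; the two signs cancel. *)
  by rewrite r -[in LHS]opprB -[d n m.-1 - _]opprB invrN mulrNN.
Qed.
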